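(* For all $n\ge2$, we have $c_n(123,213)=4\cdot 3^{n-2}$.
   Context: A word $\pi=\pi_1\dots\pi_m$ over the positive integers contains the pattern $\sigma=\sigma_1\dots\sigma_k$ if there are indices $1\le i_1<\dots<i_k\le m$ such that for all $r,s\in\{1,\dots,k\}$: $\pi_{i_r}<\pi_{i_s}$ iff $\sigma_r<\sigma_s$, and $\pi_{i_r}=\pi_{i_s}$ iff $\sigma_r=\sigma_s$; otherwise $\pi$ avoids $\sigma$. $\mathcal{C}_n$ denotes the set of nonnesting permutations: arrangements (words) of the multiset $\{1,1,2,2,\dots,n,n\}$ that avoid the patterns $1221$ and $2112$. For patterns $\sigma,\tau,\dots$, $c_n(\sigma,\tau,\dots)$ is the number of $\pi\in\mathcal{C}_n$ avoiding all of $\sigma,\tau,\dots$. *)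

(* Defs.v *)
From mathcomp Require Import all_boot.

Set Implicit Arguments.
Unset Strict Implicit.
Unset Printing Implicit Defensive.

(* f is the sequence of positions i_1 < ... < i_k (counted from 0) at which
   p occurs in w. *)
Definition occurrence (w p : seq nat)
    (f : {ffun 'I_(size p) -> 'I_(size w)}) : bool :=
  [forall r : 'I_(size p), forall s : 'I_(size p),
    [&& (r < s) ==> (f r < f s),
        (nth 0 w (f r) < nth 0 w (f s)) == (nth 0 p r < nth 0 p s)
      & (nth 0 w (f r) == nth 0 w (f s)) == (nth 0 p r == nth 0 p s)]].

Definition contains (w p : seq nat) : bool :=
  [exists f : {ffun 'I_(size p) -> 'I_(size w)}, occurrence f].

Definition avoids (w p : seq nat) : bool := ~~ contains w p.

Definition double_word (n : nat) : seq nat :=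
  flatten [seq [:: i; i] | i <- iota 1 n].

(* [permutations s] is duplicate-free even when s has repeated letters, so each
   nonnesting permutation is listed exactly once. *)
Definition nonnesting (n : nat) : seq (seq nat) :=
  [seq w <- permutations (double_word n)
     | avoids w [:: 1; 2; 2; 1] && avoids w [:: 2; 1; 1; 2]].

Definition c (n : nat) (ps : seq (seq nat)) : nat :=
  count (fun w => all (avoids w) ps) (nonnesting n).

(* Main.v *)
Require Import Defs.
From mathcomp Require Import all_boot zify.

Set Implicit Arguments.
Unset Strict Implicit.
Unset Printing Implicit Defensive.

(** The count grows one letter value at a time, by adding and removing the two
    copies of the largest letter [m].

    Call a word good if it is a nonnesting permutation avoiding 123 and 213.
    The two avoided patterns say together that two letters standing before a
    larger letter must be equal.  Applied to the second [m] of a good word, this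
    makes all the letters before it, other than [m], copies of one value [a];
    there are at most two of them.  Nonnesting excludes [m a a m], and also
    [a m m] when the other [a] comes later.  What remains are the words
    [m m w], [m a m v] where [w = a v], and, when [w = a a u], also
    [a a m m u] and [a m a m u]; here [w] is the word with both copies of [m]
    removed, itself good ([good_child]).  Conversely every word of these shapes
    built on a good [w] is good ([child_good]).

    So a good word has four children if it starts with a twin, that is with two
    equal letters, and two children otherwise; among its children, two
    respectively one start with a twin ([children_stat]).  Hence if there are
    [s] good words, [t] of them starting with a twin, the next size has
    [s + t] words starting with a twin and [2 * (s + t)] words in all.  From
    size 2 on exactly half of the words start with a twin, so each step
    multiplies the count by 3, starting from the 4 words of size 2. *)

(** * Pattern containment through subsequences *)

Definition same_order (s p : seq nat) : bool :=
  (size s == size p) &&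
  all (fun r => all (fun t =>
         ((nth 0 s r < nth 0 s t) == (nth 0 p r < nth 0 p t)) &&
         ((nth 0 s r == nth 0 s t) == (nth 0 p r == nth 0 p t)))
       (iota 0 (size p))) (iota 0 (size p)).

Lemma subseq_iota (s : seq nat) (n : nat) :
  sorted ltn s -> all (gtn n) s -> subseq s (iota 0 n).
Proof.
move=> s_sorted /allP s_lt.
have -> : s = [seq i <- iota 0 n | i \in s].
  apply: (irr_sorted_eq ltn_trans ltnn) => //.
    by rewrite sorted_filter ?iota_ltn_sorted //; apply: ltn_trans.
  move=> i; rewrite mem_filter mem_iota /=.
  by case: (boolP (i \in s)) => // /s_lt /= ->.
exact: filter_subseq.
Qed.

(** Replaces the positions of an occurrence by the subsequence read there, so that
    containment can be handled with the theory of [subseq]. *)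
Lemma containsP (w p : seq nat) :
  reflect (exists2 s, subseq s w & same_order s p) (contains w p).
Proof.
apply: (iffP existsP) => [[f /forallP occ]|].
  have occ' r t := elimTF and3P (forallP (occ r) t).
  pose idx := [seq nat_of_ord (f r) | r <- enum 'I_(size p)].
  have nth_idx (r : 'I_(size p)) : nth 0 (map (nth 0 w) idx) r = nth 0 w (f r).
    by rewrite -map_comp (nth_map r) ?size_enum_ord // nth_ord_enum.
  exists (map (nth 0 w) idx).
    rewrite -[X in subseq _ X]take_size -(map_nth_iota0 0 (leqnn (size w))).
    apply/map_subseq/subseq_iota; last by apply/allP => _ /mapP[r _ ->] /=.
    have : sorted ltn (map val (enum 'I_(size p))).
      by rewrite val_enum_ord iota_ltn_sorted.
    rewrite !sorted_map; apply: sub_sorted => r t /= lt_rt.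
    by have [/implyP /(_ lt_rt)] := occ' r t.
  rewrite /same_order 2!size_map size_enum_ord eqxx /=.
  apply/allP => r; rewrite mem_iota add0n => rp.
  apply/allP => t; rewrite mem_iota add0n => tp.
  have [_ lt_eq eq_eq] := occ' (Ordinal rp) (Ordinal tp).
  by rewrite (nth_idx (Ordinal rp)) (nth_idx (Ordinal tp)) lt_eq eq_eq.
case=> s /subseqP[b szb ->] /andP[/eqP szs /allP iso].
pose idx := mask b (iota 0 (size w)).
have w_idx : mask b w = map (nth 0 w) idx.
  by rewrite map_mask map_nth_iota0 // take_size.
have szi : size idx = size p by rewrite -szs w_idx size_map.
have idx_lt (r : 'I_(size p)) : nth 0 idx r < size w.
  have : nth 0 idx r \in iota 0 (size w).
    by apply: (mem_subseq (mask_subseq b _)); rewrite -/idx mem_nth ?szi.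
  by rewrite mem_iota.
exists [ffun r => Ordinal (idx_lt r)]; apply/forallP => r; apply/forallP => t.
have ord_mem (q : 'I_(size p)) : nat_of_ord q \in iota 0 (size p).
  by rewrite mem_iota ltn_ord.
have := allP (iso r (ord_mem r)) t (ord_mem t).
rewrite w_idx !(nth_map 0) ?szi // !ffunE /= => /andP[-> ->]; rewrite !andbT.
apply/implyP => lt_rt; apply: (sorted_ltn_nth ltn_trans) => //; rewrite ?inE ?szi //.
exact: (subseq_sorted ltn_trans (mask_subseq _ _) (iota_ltn_sorted _ _)).
Qed.

(** As [a] and [b] are unordered, this covers both 1221 and 2112. *)
Definition nest_free (w : seq nat) : Prop :=
  forall a b, subseq [:: a; b; b; a] w -> a = b.

(** The joint content of avoiding 123 and 213: [a] and [b] are unordered. *)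
Definition one_below (w : seq nat) : Prop :=
  forall a b m, subseq [:: a; b; m] w -> a < m -> b < m -> a = b.

Lemma nest_freeP (w : seq nat) :
  reflect (nest_free w) (avoids w [:: 1; 2; 2; 1] && avoids w [:: 2; 1; 1; 2]).
Proof.
rewrite -negb_or; apply: (iffP idP).
  move=> /norP[no1221 no2112] a b abba; apply/eqP/contraT => neq_ab.
  move: neq_ab; rewrite neq_ltn => /orP[lt_ab|lt_ba].
    case/negP: no1221; apply/containsP; exists [:: a; b; b; a] => //.
    by rewrite /same_order /=; lia.
  case/negP: no2112; apply/containsP; exists [:: a; b; b; a] => //.
  by rewrite /same_order /=; lia.
move=> nf; apply/norP; split; apply/containsP => -[[|x [|y [|z [|t [|u s]]]]]] // sub.
  rewrite /same_order /= => ord; have [xt yz] : x = t /\ y = z by lia.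
  by move: sub; rewrite -xt -yz => /nf; lia.
rewrite /same_order /= => ord; have [xt yz] : x = t /\ y = z by lia.
by move: sub; rewrite -xt -yz => /nf; lia.
Qed.

Lemma one_belowP (w : seq nat) :
  reflect (one_below w) (avoids w [:: 1; 2; 3] && avoids w [:: 2; 1; 3]).
Proof.
rewrite -negb_or; apply: (iffP idP).
  move=> /norP[no123 no213] a b m abm lt_am lt_bm; apply/eqP/contraT => neq_ab.
  move: neq_ab; rewrite neq_ltn => /orP[lt_ab|lt_ba].
    case/negP: no123; apply/containsP; exists [:: a; b; m] => //.
    by rewrite /same_order /=; lia.
  case/negP: no213; apply/containsP; exists [:: a; b; m] => //.
  by rewrite /same_order /=; lia.
move=> ob; apply/norP; split; apply/containsP => -[[|x [|y [|z [|u s]]]]] // /ob;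
  by rewrite /same_order /=; lia.
Qed.

(** * Letter counts in good words *)

Definition good (n : nat) (w : seq nat) : Prop :=
  [/\ perm_eq w (double_word n), nest_free w & one_below w].

Lemma double_wordS (n : nat) :
  double_word n.+1 = double_word n ++ [:: n.+1; n.+1].
Proof. by rewrite /double_word -{1}(addn1 n) iotaD map_cat flatten_cat. Qed.

Lemma count_double_word (n x : nat) :
  count_mem x (double_word n) = ((0 < x) && (x <= n)).*2.
Proof.
elim: n => [|n IHn]; first by case: x.
by rewrite double_wordS count_cat IHn /=; lia.
Qed.

Lemma good_count (n x : nat) (w : seq nat) :
  good n w -> count_mem x w = ((0 < x) && (x <= n)).*2.
Proof. by case=> /permP -> _ _; rewrite count_double_word. Qed.

Lemma good_mem (n x : nat) (w : seq nat) :
  good n w -> (x \in w) = (0 < x) && (x <= n).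
Proof.
by move=> /(good_count x); rewrite -has_pred1 has_count => ->; rewrite double_gt0 lt0b.
Qed.

(** * Adding two copies of a largest letter *)

(** For [w] good and [m] above its letters, these are the insertions of two copies
    of [m] that create neither a nesting nor distinct letters before an [m]
    larger than both. *)
Variant child (m : nat) : seq nat -> seq nat -> Prop :=
| FrontPair w : child m w [:: m, m & w]
| FrontStraddle a v : child m (a :: v) [:: m, a, m & v]
| AfterTwin a u : child m [:: a, a & u] [:: a, a, m, m & u]
| StraddleTwin a u : child m [:: a, a & u] [:: a, m, a, m & u].

(** [AfterTwin] and [StraddleTwin] need the first two letters of [w] to agree, which
    is what makes the number of children depend on how [w] starts. *)
Definition children (m : nat) (w : seq nat) : seq (seq nat) :=
  [:: m, m & w] ::
  (if w is a :: v then
     [:: m, a, m & v] ::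
     (if v is b :: u then
        if a == b then [:: [:: a, a, m, m & u]; [:: a, m, a, m & u]] else [::]
      else [::])
   else [::]).

Lemma childP (m : nat) (w x : seq nat) :
  reflect (child m w x) (x \in children m w).
Proof.
apply: (iffP idP) => [|[]]; last first.
- by move=> a u; rewrite /children eqxx !inE ?eqxx ?orbT.
- by move=> a u; rewrite /children eqxx !inE ?eqxx ?orbT.
- by move=> a v; rewrite /= !(in_cons, eqxx, orbT).
- by move=> v; rewrite /= !(in_cons, eqxx, orbT).
case: w => [|a [|b u]]; rewrite /children.
- by rewrite inE => /eqP ->; constructor.
- by rewrite !inE => /orP[] /eqP ->; constructor.
case: (a =P b) => [<-|_]; rewrite !inE; last by case/orP=> /eqP ->; constructor.
by case/or4P=> /eqP ->; constructor.
Qed.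

(** A child determines its parent, so distinct words have disjoint sets of
    children. *)
Lemma filter_child (m : nat) (w x : seq nat) :
  m \notin w -> child m w x -> [seq y <- x | y != m] = w.
Proof.
move=> mw; have w_id : [seq y <- w | y != m] = w.
  by apply/all_filterP/allP => y yw; apply: contraNneq mw => <-.
move=> wx; move: w_id mw; case: w x / wx => [w|a v|a u|a u] w_id mw;
  rewrite -[RHS]w_id /= eqxx //=.
Qed.

Lemma perm_child (m : nat) (w x : seq nat) :
  child m w x -> perm_eq x (w ++ [:: m; m]).
Proof.
by move=> wx; apply/permP => P; rewrite count_cat; case: w x / wx => * /=; lia.
Qed.

(** Whether [m] nests with [z] depends only on the copies of [m] and [z]; this lets
    such a question be settled inside the children of [z z]. *)
Lemma child_filter (m : nat) (P : pred nat) (w x : seq nat) :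
  P m -> child m w x -> child m (filter P w) (filter P x).
Proof.
move=> Pm; case=> [v|a v|a u|a u] /=; rewrite Pm.
- exact: FrontPair.
- by case: (P a); [exact: FrontStraddle|exact: FrontPair].
- by case: (P a); [exact: AfterTwin|exact: FrontPair].
by case: (P a); [exact: StraddleTwin|exact: FrontPair].
Qed.

(** After projection to the letters [m] and [z] the parent becomes [z], repeated at
    most twice, and its few children can be inspected one by one. *)
Lemma child_nest_free (m z : nat) (w x : seq nat) :
  m \notin w -> z != m -> count_mem z w <= 2 -> child m w x ->
  ~~ subseq [:: m; z; z; m] x && ~~ subseq [:: z; m; m; z] x.
Proof.
move=> mw zm le2 wx; have mz := zm; rewrite eq_sym in mz.
pose P := pred2 m z.
have wP : filter P w = nseq (count_mem z w) z.
  have -> : filter P w = filter (pred1 z) w.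
    apply: eq_in_filter => y yw /=; suff /negbTE -> : y != m by [].
    by apply: contraNneq mw => <-.
  by rewrite -size_filter; apply/all_pred1P/filter_all.
have inP s : all P s -> subseq s x -> subseq s (filter P x).
  by move=> Ps; rewrite subseq_filter Ps.
have /childP : child m (filter P w) (filter P x).
  by apply: child_filter => //=; rewrite eqxx.
have Pm : P m by rewrite /= eqxx.
have Pz : P z by rewrite /= eqxx orbT.
move=> xP; apply/andP; split; apply/negP => /inP; rewrite /all Pm Pz => /(_ isT);
  move: xP; rewrite {}wP; case: (count_mem z w) le2 => [|[|[|k]]] // _;
  rewrite /children /nseq /ncons /= ?eqxx !inE.
- by move=> /eqP ->; do 5 rewrite /= ?(eqxx, negbTE zm, negbTE mz).
- by case/orP=> /eqP ->; do 5 rewrite /= ?(eqxx, negbTE zm, negbTE mz).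
- by case/or4P=> /eqP ->; do 5 rewrite /= ?(eqxx, negbTE zm, negbTE mz).
- by move=> /eqP ->; do 5 rewrite /= ?(eqxx, negbTE zm, negbTE mz).
- by case/orP=> /eqP ->; do 5 rewrite /= ?(eqxx, negbTE zm, negbTE mz).
- by case/or4P=> /eqP ->; do 5 rewrite /= ?(eqxx, negbTE zm, negbTE mz).
Qed.

Lemma subseq_rcons_cat (m : nat) (s p v : seq nat) :
  m \notin v -> subseq (rcons s m) (p ++ v) -> subseq s p.
Proof.
move=> mv; elim: p s => [|y p IHp] [|z s] //=.
  move=> /mem_subseq/(_ m); rewrite in_cons mem_rcons mem_head orbT => mv'.
  by rewrite mv' in mv.
by rewrite -rcons_cons; case: eqP => _ /IHp.
Qed.

(** Up to its last [m], a child contains besides [m] at most one value [y]. *)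
Lemma child_one_below (m a b : nat) (w x : seq nat) :
  m \notin w -> a != m -> b != m -> child m w x -> subseq [:: a; b; m] x -> a = b.
Proof.
move=> mw am bm wx.
(* When no letter precedes the last m other than m, any y will do. *)
have [p [v [-> mv [y /allP py]]]] : exists p v,
  [/\ x = p ++ v, m \notin v & exists y, all (pred2 y m) p].
  move: mw; case: w x / wx => [v|y v|y v|y v]; rewrite ?inE ?negb_or => mv.
  - by exists [:: m; m], v; split=> //; exists m; rewrite /= eqxx.
  - case/andP: mv => _ mv.
    by exists [:: m; y; m], v; split=> //; exists y; rewrite /= !eqxx !orbT.
  - case/and3P: mv => _ _ mv.
    by exists [:: y; y; m; m], v; split=> //; exists y; rewrite /= !eqxx !orbT.
  case/and3P: mv => _ _ mv.
  by exists [:: y; m; y; m], v; split=> //; exists y; rewrite /= !eqxx !orbT.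
move=> /(@subseq_rcons_cat m [:: a; b] p v mv)/mem_subseq abp.
have /= := py a (abp a (mem_head _ _)); have := py b (abp b _).
rewrite !inE eqxx orbT (negbTE am) (negbTE bm) !orbF.
by move=> /(_ isT)/eqP -> /eqP ->.
Qed.

(** A forbidden pattern without [m] already occurs in the parent, and one with [m]
    is a nesting of [m] or uses [m] as its largest letter. *)
Lemma child_good (n : nat) (w x : seq nat) :
  good n w -> child n.+1 w x -> good n.+1 x.
Proof.
set m := n.+1 => gw wx; have [pw nfw obw] := gw.
have mNw : m \notin w by rewrite (good_mem _ gw) ltnn andbF.
have subw s : m \notin s -> subseq s x -> subseq s w.
  move=> ms sx; rewrite -(filter_child mNw wx) subseq_filter sx andbT.
  by apply/allP => y ys; apply: contraNneq ms => <-.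
have px : perm_eq x (double_word m).
  rewrite double_wordS (perm_trans (perm_child wx)) //.
  by rewrite perm_cat2r.
have le_x y : y \in x -> y <= m.
  rewrite (perm_mem px) -has_pred1 has_count count_double_word; lia.
have nest z : z != m -> ~~ subseq [:: m; z; z; m] x && ~~ subseq [:: z; m; m; z] x.
  move=> zm; apply: child_nest_free mNw zm _ wx.
  by rewrite (good_count _ gw); case: (_ && _).
split=> // [a b abba|a b c abc lt_ac lt_bc].
  have [am|am] := eqVneq a m; have [bm|bm] := eqVneq b m.
  - by rewrite am bm.
  - by have := nest b bm; rewrite -am abba.
  - by have := nest a am; rewrite -bm abba andbF.
  by apply/nfw/subw => //; rewrite !inE !negb_or ![m == _]eq_sym am bm.
have le_cm : c <= m by apply/le_x/(mem_subseq abc); rewrite !inE eqxx !orbT.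
have [am bm] : a != m /\ b != m by lia.
have [cm|cm] := eqVneq c m.
  by apply: (child_one_below mNw am bm wx) => //; rewrite -cm.
apply: (obw a b c) => //; apply: subw => //.
by rewrite !inE !negb_or ![m == _]eq_sym am bm.
Qed.

(** * Removing the two copies of the largest letter *)

Lemma split_first (m : nat) (s : seq nat) :
  m \in s -> exists p v, s = p ++ m :: v /\ m \notin p.
Proof.
elim: s => // y s IHs; rewrite in_cons; have [<- _|neq_my] := eqVneq m y.
  by exists [::], s.
move=> /IHs[p [v [-> mp]]]; exists (y :: p), v.
by rewrite inE negb_or neq_my.
Qed.

(** The letters [p ++ r] before the second [m] all lie below it, so they are equal,
    and there are at most two of them.  Each way of distributing them around the
    first [m] is one of the shapes of [child], or a nesting. *)
Lemma good_child (n : nat) (x : seq nat) :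
  good n.+1 x -> exists2 w, good n w & child n.+1 w x.
Proof.
set m := n.+1 => gx; have [px nfx obx] := gx.
suff [w wx mw] : exists2 w, child m w x & m \notin w.
  exists w => //; have subx : subseq w x.
    by rewrite -(filter_child mw wx) filter_subseq.
  split.
  - rewrite -(perm_cat2r [:: m; m]) -double_wordS -/m.
    by apply: perm_trans px; rewrite perm_sym perm_child.
  - by move=> a b /subseq_trans/(_ subx); apply: nfx.
  by move=> a b c /subseq_trans/(_ subx); apply: obx.
have cnt y : count_mem y x = (y \in x).*2.
  by rewrite (good_count _ gx) (good_mem _ gx).
have lt_x y : y \in x -> y != m -> y < m.
  by rewrite (good_mem _ gx) => /andP[_]; rewrite leq_eqVlt => /orP[->|].
have := good_count m gx; rewrite leqnn /=.
have : m \in x by rewrite (good_mem _ gx) leqnn.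
move=> /split_first[p [q [x_pq mp]]].
rewrite {1}x_pq count_cat (count_memPn mp) /= eqxx => cq.
have {}cq : count_mem m q = 1 by case: cq.
have /split_first[r [v [q_rv mr]]] : m \in q by rewrite -has_pred1 has_count cq.
have mv : m \notin v.
  move: cq; rewrite q_rv count_cat (count_memPn mr) /= eqxx => -[].
  by move=> /eqP; rewrite -leqn0 leqNgt -has_count has_pred1.
have x_eq : x = (p ++ m :: r) ++ m :: v by rewrite x_pq q_rv -catA.
have sub_pr : subseq (p ++ r) (p ++ m :: r) by rewrite cat_subseq ?subseq_cons.
have const a b : subseq [:: a; b] (p ++ r) -> a = b.
  move=> ab; have lt_m y : y \in [:: a; b] -> y < m.
    move=> /(mem_subseq ab) y_pr; apply: lt_x.
      by rewrite x_eq mem_cat (mem_subseq sub_pr y_pr).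
    by apply: contraTneq y_pr => ->; rewrite mem_cat (negbTE mp).
  apply: (obx a b m); rewrite ?lt_m ?inE ?eqxx ?orbT //.
  rewrite x_eq; apply: (cat_subseq (s1 := [:: a; b])) (subseq_trans ab sub_pr) _.
  by rewrite sub1seq mem_head.
have size_pr : size (p ++ r) <= 2.
  case prE: (p ++ r) => [//|a t].
  have le2 : count_mem a x <= 2 by rewrite cnt; case: (_ \in _).
  apply: leq_trans le2; rewrite x_eq count_cat; apply: leq_trans (leq_addr _ _).
  apply: leq_trans (leq_count_subseq _ sub_pr); rewrite prE /= eqxx ltnS.
  rewrite leq_eqVlt eq_sym -all_count; apply/orP; left; apply/allP => b bt /=.
  by rewrite -(const a b) // prE /= eqxx sub1seq.
have nest a : a != m -> ~~ subseq [:: m; a; a; m] x && ~~ subseq [:: a; m; m; a] x.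
  by move=> am; apply/andP; split; apply/negP => /nfx; apply/eqP; rewrite // eq_sym.
clear gx px nfx obx lt_x x_pq q_rv cq sub_pr; subst x.
case: p mp const size_pr nest cnt => [|a p] mp const size_pr nest cnt;
  case: r mr const size_pr nest cnt => [|d r] mr const size_pr nest cnt.
- by exists v => //; apply: FrontPair.
- move: mr; rewrite inE negb_or => /andP[md mr].
  case: r mr const size_pr nest {cnt} => [|e [|? r]] // mr const _ nest.
    by exists (d :: v); [apply: FrontStraddle|rewrite inE negb_or md].
  have /andP[/negP[]] := nest d (contra_neq (@esym _ _ _) md).
  rewrite -(const d e) ?subseq_refl //.
  exact: (prefix_subseq [:: m; d; d; m] v).
- move: mp; rewrite inE negb_or => /andP[ma mp].
  case: p mp const size_pr nest cnt => [|b [|? p]] // mp const _ nest cnt.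
    (* The second copy of a can only come after both m's. *)
    have av : a \in v.
      have := cnt a; rewrite /= !inE eqxx (negbTE ma) => -[].
      rewrite !add0n => cv.
      by rewrite -has_pred1 has_count cv.
    have /andP[_ /negP[]] := nest a (contra_neq (@esym _ _ _) ma).
    by rewrite (cat_subseq (s1 := [:: a; m; m]) (s3 := [:: a; m; m])) ?sub1seq.
  exists [:: a, a & v]; last by rewrite !inE !negb_or ma.
  rewrite -(const a b) ?subseq_refl //; exact: AfterTwin.
case: p mp const size_pr {nest cnt} => [|? [|? p]] // mp const.
case: r mr const => [|? r] // mr const _.
have ma : m != a by rewrite inE in mp.
exists [:: a, a & v]; last by rewrite !inE !negb_or ma.
rewrite -(const a d) ?subseq_refl //; exact: StraddleTwin.
Qed.

(** * Counting by generations *)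

Fixpoint generation (n : nat) : seq (seq nat) :=
  if n is n'.+1 then flatten [seq children n w | w <- generation n']
  else [:: [::]].

Lemma generationP (n : nat) (w : seq nat) :
  reflect (good n w) (w \in generation n).
Proof.
elim: n w => [|n IHn] w /=.
  rewrite inE; apply: (iffP eqP) => [->|[/perm_nilP]] //.
apply: (iffP flatten_mapP) => [[v /IHn gv /childP vw]|/good_child].
  exact: child_good gv vw.
by case=> v /IHn gv /childP vw; exists v.
Qed.

Lemma uniq_children (m : nat) (w : seq nat) : m \notin w -> uniq (children m w).
Proof.
case: w => [|a w] //; rewrite inE negb_or => /andP[/negbTE ma _].
case: w => [|b u].
  by rewrite /children /= inE !eqseq_cons ma !andbF.
by rewrite /children; case: (a =P b) => [<-|_];
  rewrite /= !inE !eqseq_cons ![a == m]eq_sym ma /= ?andbF.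
Qed.

Lemma generation_uniq (n : nat) : uniq (generation n).
Proof.
elim: n => //= n IHn.
have: {in generation n, forall w, n.+1 \notin w}.
  by move=> w /generationP gw; rewrite (good_mem _ gw) ltnn andbF.
elim: (generation n) IHn => // w s IHs /andP[ws us] ms.
have mw := ms w (mem_head _ _).
rewrite -[flatten _]/(children n.+1 w ++ flatten (map (children n.+1) s)).
rewrite cat_uniq uniq_children // IHs ?andbT //=; last first.
  by move=> v vs; apply: ms; rewrite in_cons vs orbT.
apply/hasPn => x /flatten_mapP[v vs /childP vx]; apply: contra ws => /childP wx.
have mv : n.+1 \notin v by apply: ms; rewrite in_cons vs orbT.
by rewrite -(filter_child mw wx) (filter_child mv vx).
Qed.

Lemma c_generation (n : nat) :
  c n [:: [:: 1; 2; 3]; [:: 2; 1; 3]] = size (generation n).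
Proof.
rewrite /c -size_filter; apply/perm_size/uniq_perm.
- by rewrite !filter_uniq ?permutations_uniq.
- exact: generation_uniq.
move=> w; rewrite !mem_filter mem_permutations [all _ _]/= andbT.
apply/idP/generationP => [/and3P[/one_belowP obw /nest_freeP nfw pw] //|].
by case=> -> /nest_freeP -> /one_belowP ->.
Qed.

Definition starts_twin (w : seq nat) : bool := nth 0 w 0 == nth 0 w 1.

(** With [k = 1] if [w] starts with a twin and [k = 0] otherwise, [w] has
    [2 * k.+1] children.  The twin starts among them are those of [m m w] and, when
    [w] has one, of [a a m m u]. *)
Lemma children_stat (m : nat) (w : seq nat) : m \notin w -> 1 < size w ->
  size (children m w) = 2 * (starts_twin w).+1 /\
  count starts_twin (children m w) = (starts_twin w).+1.
Proof.
case: w => [|a [|b u]] // mw _; move: mw; rewrite inE negb_or => /andP[/negbTE ma _].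
rewrite /children /starts_twin /=.
by case: eqP => _; rewrite /= ?eqxx ?ma ?[a == m]eq_sym ?ma.
Qed.

(** The recursion fails at the empty word, which has one child, so it is used from
    the second size on; there half of the words start with a twin, and this
    proportion is preserved. *)
Lemma generation_stat (n : nat) :
  size (generation n.+2) = 4 * 3 ^ n /\
  count starts_twin (generation n.+2) = 2 * 3 ^ n.
Proof.
have step k : 0 < k ->
    count starts_twin (generation k.+1) =
      size (generation k) + count starts_twin (generation k)
    /\ size (generation k.+1) = 2 * count starts_twin (generation k.+1).
  move=> k_gt0 /=.
  have: {in generation k, forall w, k.+1 \notin w /\ 1 < size w}.
    move=> w /generationP gw; rewrite (good_mem _ gw) ltnn andbF; split=> //.
    apply: leq_trans (count_size (pred1 1) w).
    by rewrite (good_count _ gw) k_gt0.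
  elim: (generation k) => // w s IHs ws.
  have [mw szw] := ws w (mem_head _ _).
  have [szc cntc] := children_stat mw szw.
  rewrite -[flatten _]/(children k.+1 w ++ flatten (map (children k.+1) s)).
  rewrite size_cat count_cat szc cntc /=.
  have [|-> ->] := IHs; last by lia.
  by move=> v vs; apply: ws; rewrite in_cons vs orbT.
elim: n => [|n [IHs IHt]]; first by [].
have [st sz] := step n.+2 isT.
by rewrite sz st IHs IHt expnS; lia.
Qed.

Theorem theorem2p9 (n : nat) (hn : 2 <= n) :
  c n [:: [:: 1; 2; 3]; [:: 2; 1; 3]] = 4 * 3 ^ (n - 2).
Proof.
case: n hn => [|[|n]] // _; rewrite c_generation !subSS subn0.
by case: (generation_stat n).
Qed.
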